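(* Let $\Lambda$ be a row-finite, locally-convex $k$-graph and $R$ a commutative ring with $1$. Let $J$ be a basic ideal of $KP_R(\Lambda)$. If the $k$-graph $\Lambda\setminus H(J)$ satisfies Condition (B), then $J=I(H(J))$; in particular $J$ is basic and graded.
   Context: A $k$-graph $(\Lambda,d)$ is a countable category with a functor $d:\Lambda\to\mathbb{N}^k$ satisfying unique factorization ($d(\lambda)=m+n$ implies unique $\lambda=\mu\nu$ with $d(\mu)=m,d(\nu)=n$). Paths, vertices $\Lambda^0$ (degree-$0$ paths), range $r$, source $s$, coordinatewise order on $\mathbb{N}^k$, generators $e_i$, $v\Lambda^m=\{\lambda:r(\lambda)=v,d(\lambda)=m\}$. Row-finite: each $v\Lambda^m$ finite. $\Lambda^{\le n}=\{\lambda: d(\lambda)\le n,\ d(\lambda)_i<n_i\Rightarrow s(\lambda)\Lambda^{e_i}=\emptyset\}$. Locally-convex: for $i\ne j$, $\lambda\in v\Lambda^{e_i}$, $\mu\in v\Lambda^{e_j}$, the sets $s(\lambda)\Lambda^{e_j}$, $s(\mu)\Lambda^{e_i}$ are nonempty. For $H\subseteq\Lambda^0$, $\Lambda\setminus H$ is the subcategory with objects $\Lambda^0\setminus H$ and morphisms $\{\lambda: r(\lambda),s(\lambda)\notin H\}$, restricted degree. Boundary paths and Condition (B): for $m\in(\mathbb{N}\cup\{\infty\})^k$, $\Omega_{k,m}$ is the $k$-graph with objects $\{p\in\mathbb{N}^k:p\le m\}$, morphisms $(p,q)$ with $p\le q\le m$, $r(p,q)=p$, $s(p,q)=q$, $(p,q)(q,t)=(p,t)$,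 $d(p,q)=q-p$. A boundary path is a degree-preserving functor $x:\Omega_{k,m}\to\Lambda$ such that whenever an object $p$ of $\Omega_{k,m}$ satisfies $p\,\Omega_{k,m}^{\le e_i}=\{p\}$, also $x(p)\Lambda^{\le e_i}=\{x(p)\}$. $r(x)=x(0)$, $v\Lambda^{\le\infty}$ is the set of boundary paths with range $v$, and for $\lambda\in\Lambda$ with $s(\lambda)=r(x)$, $\lambda x$ is the boundary path obtained by concatenation. A vertex $v$ satisfies Condition (B) if there exists $x\in v\Lambda^{\le\infty}$ such that for all $\alpha\ne\beta$ in $\Lambda$ (with $s(\alpha)=s(\beta)=v$) we have $\alpha x\ne\beta x$; a $k$-graph satisfies Condition (B) if every vertex does. $KP_R(\Lambda)$ ($R$ commutative with $1$) is the universal $R$-algebra generated by $p_v$ ($v\in\Lambda^0$), $s_\lambda, s_{\lambda^*}$ (non-vertex $\lambda$) subject to (KP1) $p_v$ mutually orthogonal idempotents; (KP2) $s_\lambda s_\mu=s_{\lambda\mu}$, $s_{\mu^*}s_{\lambda^*}=s_{(\lambda\mu)^*}$, $p_{r(\lambda)}s_\lambda=s_\lambda=s_\lambda p_{s(\lambda)}$, $p_{s(\lambda)}s_{\lambda^*}=s_{\lambda^*}=s_{\lambda^*}p_{r(\lambda)}$; (KP3) $s_{\lambda^*}s_\mu=\delta_{\lambda,\mu}p_{s(\lambda)}$ for $\lambda,\mu\in\Lambda^{\le n}$, $n\ne0$; (KP4) $p_v=\sum_{\lambda\in v\Lambda^{\le n}}s_\lambda s_{\lambda^*}$ for $n\ne0$.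 It is $\mathbb{Z}^k$-graded by $KP_R(\Lambda)_n=\mathrm{span}\{s_\alpha s_{\beta^*}:d(\alpha)-d(\beta)=n\}$; graded ideals contain the homogeneous components of their elements. An ideal $I$ is basic if $rp_v\in I$ with $r\ne0$ implies $p_v\in I$. $H(I)=\{v: p_v\in I\}$; $I(H)$ is the ideal generated by $\{p_v:v\in H\}$. *)

(* Defs.v *)
From HB Require Import structures.
From mathcomp Require Import all_boot all_order all_algebra.
Set Implicit Arguments.
Unset Strict Implicit.
Unset Printing Implicit Defensive.
Import GRing.Theory.
Local Open Scope ring_scope.

Definition deg (k : nat) := {ffun 'I_k -> nat}.
Definition dzero k : deg k := [ffun => 0%N].
Definition dadd k (m n : deg k) : deg k := [ffun i => (m i + n i)%N].
Definition dsub k (m n : deg k) : deg k := [ffun i => (m i - n i)%N].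
Definition dle k (m n : deg k) : Prop := forall i, (m i <= n i)%N.
Definition dunit k (i : 'I_k) : deg k := [ffun j => (j == i : nat)].

(* ---------- k-graphs: a countable small category with a degree functor
   satisfying unique factorisation.  Objects = kV, morphisms = kP;
   the vertex v is identified with the identity morphism kid v. ---------- *)
Record kgraph (k : nat) := KGraph {
  kV : countType;
  kP : countType;
  kr : kP -> kV;
  ks : kP -> kV;
  kid : kV -> kP;
  kcomp : kP -> kP -> kP;   (* kcomp l m = l m, meaningful when ks l = kr m *)
  kd : kP -> deg k;
  kr_id : forall v, kr (kid v) = v;
  ks_id : forall v, ks (kid v) = v;
  kr_comp : forall l m, ks l = kr m -> kr (kcomp l m) = kr l;
  ks_comp : forall l m, ks l = kr m -> ks (kcomp l m) = ks m;
  kcomp_idl : forall l, kcomp (kid (kr l)) l = l;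
  kcomp_idr : forall l, kcomp l (kid (ks l)) = l;
  kcompA : forall l m n, ks l = kr m -> ks m = kr n ->
      kcomp (kcomp l m) n = kcomp l (kcomp m n);
  kd_id : forall v, kd (kid v) = dzero k;
  kd_comp : forall l m, ks l = kr m -> kd (kcomp l m) = dadd (kd l) (kd m);
  kfact : forall l m n, kd l = dadd m n ->
      (exists mu nu, ks mu = kr nu /\ kcomp mu nu = l /\ kd mu = m /\ kd nu = n) /\
      (forall mu nu mu' nu',
         ks mu = kr nu -> kcomp mu nu = l -> kd mu = m -> kd nu = n ->
         ks mu' = kr nu' -> kcomp mu' nu' = l -> kd mu' = m -> kd nu' = n ->
         mu = mu' /\ nu = nu')
}.
Arguments kr {k _} _. Arguments ks {k _} _. Arguments kid {k _} _.
Arguments kcomp {k _} _ _. Arguments kd {k _} _.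

Section KGraphDefs.
Variables (k : nat) (G : kgraph k).

Definition row_finite : Prop :=
  forall (v : kV G) (m : deg k), exists s : seq (kP G),
    forall l, l \in s <-> (kr l = v /\ kd l = m).

Definition locally_convex : Prop :=
  forall (i j : 'I_k), i != j -> forall l mu : kP G,
    kr l = kr mu -> kd l = dunit i -> kd mu = dunit j ->
    (exists a : kP G, kr a = ks l /\ kd a = dunit j) /\
    (exists b : kP G, kr b = ks mu /\ kd b = dunit i).

(* Paths of the subcategory  Lambda \ H  where  keep v <-> v \notin H. *)
Definition in_sub (keep : kV G -> Prop) (l : kP G) : Prop :=
  keep (kr l) /\ keep (ks l).

Definition in_le (keep : kV G -> Prop) (n : deg k) (l : kP G) : Prop :=
  in_sub keep l /\ dle (kd l) n /\
  forall i, (kd l i < n i)%N ->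
    forall mu : kP G, in_sub keep mu -> kr mu = ks l -> kd mu <> dunit i.

Definition allV : kV G -> Prop := fun _ => True.

(* m : ('I_k -> option nat), None meaning infinity *)
Record bpath := BPath {
  bm : {ffun 'I_k -> option nat};
  bo : deg k -> kV G;             (* object map of the functor *)
  bx : deg k -> deg k -> kP G
}.

Definition le_m (p : deg k) (m : {ffun 'I_k -> option nat}) : Prop :=
  forall i, if m i is Some mi then (p i <= mi)%N else true.

Definition is_bpath (keep : kV G -> Prop) (x : bpath) : Prop :=
  (forall p, le_m p (bm x) -> keep (bo x p)) /\
  (forall p q, dle p q -> le_m q (bm x) ->
     kr (bx x p q) = bo x p /\ ks (bx x p q) = bo x q /\
     kd (bx x p q) = dsub q p) /\
  (forall p, le_m p (bm x) -> bx x p p = kid (bo x p)) /\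
  (forall p q t, dle p q -> dle q t -> le_m t (bm x) ->
     kcomp (bx x p q) (bx x q t) = bx x p t) /\
  (* boundary condition: p Omega^{<= e_i} = {p}  (i.e. m_i = p_i)
     implies x(p) (Lambda_keep)^{<= e_i} = {x(p)} *)
  (forall p i, le_m p (bm x) -> bm x i = Some (p i) ->
     forall l, (in_le keep (dunit i) l /\ kr l = bo x p) <-> l = kid (bo x p)).

Definition beq (x y : bpath) : Prop :=
  bm x = bm y /\
  forall p q, dle p q -> le_m q (bm x) -> bx x p q = bx y p q.

Definition is_concat (keep : kV G -> Prop) (l : kP G) (x z : bpath) : Prop :=
  is_bpath keep z /\
  bm z = [ffun i => omap (addn (kd l i)) (bm x i)] /\
  bx z (dzero k) (kd l) = l /\
  forall q, le_m q (bm x) -> bx z (kd l) (dadd (kd l) q) = bx x (dzero k) q.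

Definition condB_vertex (keep : kV G -> Prop) (v : kV G) : Prop :=
  exists x : bpath, is_bpath keep x /\ bo x (dzero k) = v /\
    forall a b : kP G, in_sub keep a -> in_sub keep b ->
      ks a = v -> ks b = v -> a <> b ->
      forall z1 z2, is_concat keep a x z1 -> is_concat keep b x z2 -> ~ beq z1 z2.

Definition condB (keep : kV G -> Prop) : Prop :=
  forall v, keep v -> condB_vertex keep v.

End KGraphDefs.

Record nualg (R : comPzRingType) := NUAlg {
  nucar :> lmodType R;
  numul : nucar -> nucar -> nucar;
  numulA : forall a b c, numul (numul a b) c = numul a (numul b c);
  numulDl : forall a b c, numul (a + b) c = numul a c + numul b c;
  numulDr : forall a b c, numul a (b + c) = numul a b + numul a c;
  numulZl : forall (r : R) a b, numul (r *: a) b = r *: numul a b;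
  numulZr : forall (r : R) a b, numul a (r *: b) = r *: numul a b
}.
Arguments numul {R _} _ _.

Section KP.
Variables (k : nat) (G : kgraph k) (R : comPzRingType).

(* Kumjian-Pask family (p, s, s^* ) in A;  convention s_v = s_{v^*} = p_v *)
Definition KP_family (A : nualg R) (p : kV G -> A) (s ss : kP G -> A) : Prop :=
  (forall v, s (kid v) = p v) /\ (forall v, ss (kid v) = p v) /\
  (forall v, numul (p v) (p v) = p v) /\
  (forall v w, v <> w -> numul (p v) (p w) = 0) /\
  (forall l m, ks l = kr m -> numul (s l) (s m) = s (kcomp l m)) /\
  (forall l m, ks l = kr m -> numul (ss m) (ss l) = ss (kcomp l m)) /\
  (forall l, numul (p (kr l)) (s l) = s l /\ s l = numul (s l) (p (ks l))) /\
  (forall l, numul (p (ks l)) (ss l) = ss l /\ ss l = numul (ss l) (p (kr l))) /\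
  (forall n, n <> dzero k -> forall l m, in_le (fun _ : kV G => True) n l -> in_le (fun _ : kV G => True) n m ->
     numul (ss l) (s m) = if l == m then p (ks l) else 0) /\
  (forall n, n <> dzero k -> forall v (e : seq (kP G)), uniq e ->
     (forall l, l \in e <-> (in_le (fun _ : kV G => True) n l /\ kr l = v)) ->
     p v = \sum_(l <- e) numul (s l) (ss l)).

Definition is_hom (A B : nualg R) (f : A -> B) : Prop :=
  (forall a b, f (a + b) = f a + f b) /\
  (forall (r : R) a, f (r *: a) = r *: f a) /\
  (forall a b, f (numul a b) = numul (f a) (f b)).

Definition is_KP_algebra (A : nualg R) (p : kV G -> A) (s ss : kP G -> A) : Prop :=
  KP_family p s ss /\
  forall (B : nualg R) (pB : kV G -> B) (sB ssB : kP G -> B),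
    KP_family pB sB ssB ->
    (exists f : A -> B, is_hom f /\ (forall v, f (p v) = pB v) /\
       (forall l, f (s l) = sB l) /\ (forall l, f (ss l) = ssB l)) /\
    (forall f g : A -> B, is_hom f -> is_hom g ->
       (forall v, f (p v) = g (p v)) -> (forall l, f (s l) = g (s l)) ->
       (forall l, f (ss l) = g (ss l)) -> forall a, f a = g a).

Definition is_ideal (A : nualg R) (I : A -> Prop) : Prop :=
  I 0 /\ (forall a b, I a -> I b -> I (a + b)) /\ (forall a, I a -> I (- a)) /\
  (forall a b, I a -> I (numul b a)) /\ (forall a b, I a -> I (numul a b)).

Definition basic (A : nualg R) (p : kV G -> A) (I : A -> Prop) : Prop :=
  forall (r : R) v, r != 0 -> I (r *: p v) -> I (p v).

Definition HI (A : nualg R) (p : kV G -> A) (I : A -> Prop) : kV G -> Prop :=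
  fun v => I (p v).

Definition IH (A : nualg R) (p : kV G -> A) (H : kV G -> Prop) : A -> Prop :=
  fun a => forall I : A -> Prop, is_ideal I -> (forall v, H v -> I (p v)) -> I a.

Definition homog (A : nualg R) (s ss : kP G -> A) (n : {ffun 'I_k -> int}) (a : A) : Prop :=
  exists e : seq (R * kP G * kP G),
    (forall t, t \in e -> forall i,
        n i = ((kd t.1.2 i)%:Z - (kd t.2 i)%:Z)%R) /\
    a = \sum_(t <- e) t.1.1 *: numul (s t.1.2) (ss t.2).

Definition graded (A : nualg R) (s ss : kP G -> A) (I : A -> Prop) : Prop :=
  forall e : seq ({ffun 'I_k -> int} * A),
    uniq (map fst e) -> (forall t, t \in e -> homog s ss t.1 t.2) ->
    I (\sum_(t <- e) t.2) -> forall t, t \in e -> I t.2.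

End KP.

(* Main.v *)
Require Import Defs.
From HB Require Import structures.
From mathcomp Require Import all_boot all_order all_algebra.
From mathcomp Require Import zify boolp classical_sets.

Set Implicit Arguments.
Unset Strict Implicit.
Unset Printing Implicit Defensive.
Import GRing.Theory.
Local Open Scope ring_scope.

(** Work modulo [J], with [H = H(J)].  By (KP4) every element is a combination of
    distinct [s_a s_b^*] with all [b] in one [Lambda^{<= N}].  If such a combination
    lies in [J] and [s(b)] is not in [H], take a boundary path [x] of
    [Lambda \ H] at [s(b)] as in Condition (B), and an initial segment [xi] of [x]
    so long that no other [a' xi] has a common extension with [a xi]; compressing
    by [s_{a xi}^*] and [s_{b xi}] yields [c p_{s(xi)}] in [J], where [c] is the
    coefficient of [s_a s_b^*].  As [J] is basic and [s(xi)] is not in [H], [c = 0].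
    So only the terms with source in [H], which lie in [I(H)], survive; selecting
    terms of a given degree shows in the same way that [J] is graded. *)

(** * Arithmetic and order of degrees *)

Section Degrees.
Variable k : nat.
Implicit Types m n q : deg k.

Lemma daddnK m n : dsub (dadd m n) m = n.
Proof. by apply/ffunP => i; rewrite !ffunE addKn. Qed.

Lemma dsubnKC m n : dle m n -> dadd m (dsub n m) = n.
Proof. by move=> h; apply/ffunP => i; rewrite !ffunE subnKC. Qed.

Lemma daddI m n q : dadd m n = dadd m q -> n = q.
Proof. by move=> h; rewrite -(daddnK m n) h daddnK. Qed.

Lemma dle_refl m : dle m m.
Proof. by move=> i. Qed.

Lemma dle_trans m n q : dle m n -> dle n q -> dle m q.
Proof. by move=> h1 h2 i; apply: leq_trans (h1 i) (h2 i). Qed.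

Lemma dle0 m : dle (dzero k) m.
Proof. by move=> i; rewrite ffunE. Qed.

Lemma dsub0 m : dsub m (dzero k) = m.
Proof. by apply/ffunP => i; rewrite !ffunE subn0. Qed.

Lemma dadd0 m : dadd (dzero k) m = m.
Proof. by apply/ffunP => i; rewrite !ffunE. Qed.

Lemma dadd0r m : dadd m (dzero k) = m.
Proof. by apply/ffunP => i; rewrite !ffunE addn0. Qed.

Lemma dle_addr m n : dle m (dadd m n).
Proof. by move=> i; rewrite ffunE leq_addr. Qed.

Definition dmax m n : deg k := [ffun i => maxn (m i) (n i)].

Lemma dle_maxl m n : dle m (dmax m n).
Proof. by move=> i; rewrite ffunE leq_maxl. Qed.

Lemma dle_maxr m n : dle n (dmax m n).
Proof. by move=> i; rewrite ffunE leq_maxr. Qed.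

(** The join of finitely many thresholds serves all of them at once. *)
Lemma dle_eventually_all (T : eqType) (P : T -> deg k -> Prop) (e : seq T) :
  (forall t, t \in e -> exists N, forall M, dle N M -> P t M) ->
  exists N, forall M, dle N M -> forall t, t \in e -> P t M.
Proof.
elim: e => [|t e IH] he; first by exists (dzero k).
have [N1 h1] := he t (mem_head _ _).
have [|N2 h2] := IH; first by move=> u ue; apply: he; rewrite in_cons ue orbT.
exists (dmax N1 N2) => M hM u; rewrite in_cons => /orP [/eqP ->|].
  exact/h1/(dle_trans _ hM)/dle_maxl.
exact/h2/(dle_trans _ hM)/dle_maxr.
Qed.

Lemma finite_dle n : exists e : seq (deg k), forall m, dle m n -> m \in e.
Proof.
(* Exceeds every coordinate of [n], so the degrees below [n] are functions into a finite type. *)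
pose B := (\max_i n i).+1.
exists [seq [ffun i => f i : nat] | f : {ffun 'I_k -> 'I_B}] => m hm.
apply/mapP; exists [ffun i => inord (m i)]; first by rewrite mem_enum.
apply/ffunP => i; rewrite !ffunE inordK // ltnS.
by apply: leq_trans (hm i) _; apply: leq_bigmax.
Qed.

End Degrees.

(** * Factorisation of paths and local convexity *)

Section Paths.
Variables (k : nat) (G : kgraph k).
Implicit Types (a b c l : kP G) (v : kV G) (m n p q : deg k).

(** Prefixing or suffixing [l] by an identity gives two factorisations of degrees 0 + 0, which
    uniqueness identifies. *)
Lemma kd0_id l : kd l = dzero k -> l = kid (kr l).
Proof.
move=> l0; have e : kd l = dadd (dzero k) (dzero k) by rewrite dadd0.
have [_ u] := kfact e.
by have [] := u (kid (kr l)) l l (kid (ks l)); rewrite ?ks_id ?kr_id ?kcomp_idl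
  ?kcomp_idr ?kd_id.
Qed.

Lemma kcompI a b a' b' : ks a = kr b -> ks a' = kr b' -> kd a = kd a' ->
  kcomp a b = kcomp a' b' -> a = a' /\ b = b'.
Proof.
move=> ab ab' da e; have d := kd_comp ab; have d' := kd_comp ab'.
have [_] := kfact d; apply => //.
by rewrite -e d da in d'; rewrite (daddI d').
Qed.

(** A chosen factorisation whose first part has degree [m]. The default [(l, l)] is junk, returned
    only when [m] is not below [kd l]. *)
Definition kfactor l m : kP G * kP G :=
  xget (l, l) (fun ab => ks ab.1 = kr ab.2 /\ kcomp ab.1 ab.2 = l /\ kd ab.1 = m).
Definition kpre l m := (kfactor l m).1.
Definition ksuf l m := (kfactor l m).2.

Lemma kfactorP l m : dle m (kd l) ->
  [/\ ks (kpre l m) = kr (ksuf l m), kcomp (kpre l m) (ksuf l m) = l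
    & kd (kpre l m) = m].
Proof.
move=> /dsubnKC h; have [[a [b [h1 [h2 [h3 _]]]]] _] := kfact (esym h).
by have [] := xgetPex (l, l) (ex_intro (fun ab => ks ab.1 = kr ab.2 /\
  kcomp ab.1 ab.2 = l /\ kd ab.1 = m) (a, b) (conj h1 (conj h2 h3))) => ? [].
Qed.

Lemma kfactor_comp a b m : ks a = kr b -> kd a = m ->
  kpre (kcomp a b) m = a /\ ksuf (kcomp a b) m = b.
Proof.
move=> ab <-; have d : dle (kd a) (kd (kcomp a b)).
  by rewrite kd_comp //; apply: dle_addr.
by have [h1 h2 h3] := kfactorP d; apply: kcompI.
Qed.

Lemma kd_suf l m : dle m (kd l) -> kd (ksuf l m) = dsub (kd l) m.
Proof. move=> /kfactorP [h1 h2 h3].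
by rewrite -[in RHS]h2 kd_comp // h3 daddnK. Qed.

Lemma ks_suf l m : dle m (kd l) -> ks (ksuf l m) = ks l.
Proof. by move=> /kfactorP [h1 h2 h3]; rewrite -[in RHS]h2 ks_comp. Qed.

Lemma kr_pre l m : dle m (kd l) -> kr (kpre l m) = kr l.
Proof. by move=> /kfactorP [h1 h2 h3]; rewrite -[in RHS]h2 kr_comp. Qed.

Lemma kpre_comp a b m : ks a = kr b -> dle m (kd a) ->
  kpre (kcomp a b) m = kpre a m.
Proof.
move=> ab ma; have [h1 h2 h3] := kfactorP ma.
rewrite -{1}h2 kcompA ?ks_suf //.
by have [] := @kfactor_comp (kpre a m) (kcomp (ksuf a m) b) m; rewrite ?kr_comp ?ks_suf.
Qed.

Lemma kpre_pre l m n : dle m n -> dle n (kd l) -> kpre (kpre l n) m = kpre l m.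
Proof.
move=> mn nl; have [h1 h2 h3] := kfactorP nl.
by rewrite -[in RHS]h2 kpre_comp // h3.
Qed.

Lemma kpre_id l m : kd l = m -> kpre l m = l.
Proof.
move=> h; have [] := @kfactor_comp l (kid (ks l)) m; rewrite ?kr_id //.
by rewrite kcomp_idr.
Qed.

Lemma ksuf_id l m : kd l = m -> ksuf l m = kid (ks l).
Proof.
move=> h; have [] := @kfactor_comp l (kid (ks l)) m; rewrite ?kr_id //.
by rewrite kcomp_idr.
Qed.

Lemma ksuf0 l : ksuf l (dzero k) = l.
Proof.
have [] := @kfactor_comp (kid (kr l)) l (dzero k); rewrite ?ks_id ?kd_id //.
by rewrite kcomp_idl.
Qed.

(** Prefixed by the initial segment of degree [p], both sides become the initial segment of degree
    [t]; the common prefix then cancels. *)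
Lemma kseg_comp l p q t : dle p q -> dle q t -> dle t (kd l) ->
  kcomp (ksuf (kpre l q) p) (ksuf (kpre l t) q) = ksuf (kpre l t) p.
Proof.
move=> pq qt tl.
have ql := dle_trans qt tl; have pl := dle_trans pq ql.
have [q1 q2 q3] := kfactorP ql; have [t1 t2 t3] := kfactorP tl.
have dq : dle p (kd (kpre l q)) by rewrite q3.
have dt : dle p (kd (kpre l t)) by rewrite t3; apply: dle_trans qt.
have dqt : dle q (kd (kpre l t)) by rewrite t3.
have [a1 a2 a3] := kfactorP dq; have [b1 b2 b3] := kfactorP dt.
have [c1 c2 c3] := kfactorP dqt.
have m : ks (ksuf (kpre l q) p) = kr (ksuf (kpre l t) q).
  by rewrite ks_suf // -c1 kpre_pre.
have [] // := @kcompI (kpre (kpre l q) p) (kcomp (ksuf (kpre l q) p) (ksuf (kpre l t) q))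
   (kpre (kpre l t) p) (ksuf (kpre l t) p) .
- by rewrite kr_comp.
- by rewrite a3 b3.
- by rewrite b2 -kcompA // a2 -(kpre_pre qt tl) c2.
Qed.

Lemma finite_in_le (rf : row_finite G) n v : exists e : seq (kP G), uniq e /\
  forall l, l \in e <-> (in_le (@allV k G) n l /\ kr l = v).
Proof.
have [ds hds] := finite_dle n.
have [e he] : exists e : seq (kP G), forall l, kd l \in ds -> kr l = v -> l \in e.
  elim: ds {hds} => [|m ds [e he]]; first by exists [::].
  have [e' he'] := rf v m.
  exists (e' ++ e) => l; rewrite in_cons mem_cat => /orP [/eqP lm|h] lv.
    by apply/orP; left; apply/he'.
  by rewrite he ?orbT.
exists (undup [seq l <- e | `[< in_le (@allV k G) n l /\ kr l = v >]]).
split=> [|l]; first exact: undup_uniq.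
rewrite mem_undup mem_filter; split => [/andP [/asboolP]//|h].
apply/andP; split; first exact/asboolP.
by have [[_ [h1 _]] h2] := h; apply: he => //; apply: hds.
Qed.

Lemma in_le_kd n l : kd l = n -> in_le (@allV k G) n l.
Proof.
by move=> <-; split=> //; split=> [i|i]; rewrite ?ltnn.
Qed.

Lemma in_le_comp n a b : ks a = kr b -> dle (kd a) n ->
  in_le (@allV k G) (dsub n (kd a)) b -> in_le (@allV k G) n (kcomp a b).
Proof.
move=> ab an [_ [bn h]]; split=> //; rewrite kd_comp //; split=> [i|i].
  by have := bn i; have := an i; rewrite !ffunE; lia.
rewrite ks_comp // => li; apply: h.
by have := an i; move: li; rewrite !ffunE; lia.
Qed.

Definition has_edge i v := exists l, kr l = v /\ kd l = dunit i.

Lemma has_edge_of_path i l : (0 < kd l i)%N -> has_edge i (kr l).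
Proof.
move=> li; have d : dle (dunit i) (kd l).
  by move=> j; rewrite ffunE; case: eqP => // ->.
by exists (kpre l (dunit i)); have [] := kfactorP d; rewrite kr_pre.
Qed.

(** Induction on the total length of [l]: its first edge has a colour [j] other than [i], and local
    convexity passes the [i]-edge on to the source of that edge. *)
Lemma has_edge_transport (lc : locally_convex G) i l :
  kd l i = 0%N -> has_edge i (kr l) -> has_edge i (ks l).
Proof.
move: {2}(\sum_j kd l j)%N (leqnn (\sum_j kd l j)%N) => N.
elim: N l => [|N IH] l hN li hl.
  have l0 : kd l = dzero k.
    apply/ffunP => j; rewrite ffunE; apply/eqP.
    by move: hN; rewrite leqn0 sum_nat_eq0 => /forallP/(_ j).
  by rewrite (kd0_id l0) ks_id.
case: (pselect (exists j, (0 < kd l j)%N)) => [[j lj]|h]; last first.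
  apply: IH => //; rewrite big1 // => j _.
  by apply/eqP; rewrite -leqn0 leqNgt; apply/negP => lj; apply: h; exists j.
have ji : j != i by apply/eqP => ji; rewrite ji li in lj.
have d : dle (dunit j) (kd l) by move=> t; rewrite ffunE; case: eqP => // ->.
have [h1 h2 h3] := kfactorP d.
rewrite -(ks_suf d); apply: IH; last first.
- have [e [e1 e2]] := hl.
  have [] := lc j i ji (kpre l (dunit j)) e _ h3 e2; first by rewrite kr_pre.
  by rewrite -h1.
- by rewrite kd_suf // !ffunE li.
- rewrite -ltnS; apply: leq_trans hN.
  rewrite (bigD1 j) // [X in (_ < X)%N](bigD1 j) //= kd_suf // !ffunE eqxx.
  have : (\sum_(i0 < k | i0 != j) dsub (kd l) (dunit j) i0 <=
          \sum_(i0 < k | i0 != j) kd l i0)%N.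
    by apply: leq_sum => t _; rewrite !ffunE leq_subr.
  by move: lj => /=; set x := kd l j; set S1 := (\sum_(_ < k | _) _)%N;
    set S2 := (\sum_(_ < k | _) _)%N; rewrite subn1; lia.
Qed.

End Paths.

(** * Boundary paths of the subgraph and their concatenations *)

Section BoundaryPaths.
Variables (k : nat) (G : kgraph k) (keep : kV G -> Prop).
Hypothesis lc : locally_convex G.
(** The complement of [keep] is assumed hereditary here and, in [keep_edge], saturated along edges;
    both are verified for H(J) further on. *)
Hypothesis keep_range : forall l : kP G, keep (ks l) -> keep (kr l).
Hypothesis keep_edge : forall (v : kV G) i, keep v -> has_edge i v ->
  exists l : kP G, [/\ kr l = v, kd l = dunit i & keep (ks l)].
Implicit Types (x : bpath G) (a b g h : kP G) (p q t : deg k).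

(** By [keep_edge], a kept vertex with an [i]-edge has one inside the subgraph. Hence the boundary
    condition can be tested in the whole graph, where local convexity is available. *)
Lemma boundary_no_edge (v : kV G) i : keep v ->
  (forall l, (in_le keep (dunit i) l /\ kr l = v) <-> l = kid v) <-> ~ has_edge i v.
Proof.
move=> kv; split=> [H e|ne l].
  have [l [lv li kl]] := keep_edge kv e.
  have : l = kid v.
    apply/H; split=> //; split; first by split; rewrite ?lv.
    by rewrite li; split=> [j|j]; rewrite ?ltnn.
  move=> /(congr1 (@kd _ _)); rewrite li kd_id => /ffunP/(_ i).
  by rewrite !ffunE eqxx.
split=> [[[_ [ld _]] lv]|->].
  rewrite (@kd0_id _ _ l) ?lv //; apply/ffunP => j; rewrite ffunE; apply/eqP.
  rewrite -leqn0; have := ld j; rewrite ffunE; case: eqP => // -> _.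
  by rewrite leqNgt; apply/negP => /has_edge_of_path; rewrite lv.
split; last by rewrite kr_id.
split; first by split; rewrite ?kr_id ?ks_id.
split=> [|j]; rewrite kd_id; first exact: dle0.
rewrite !ffunE; case: eqP => // -> _ mu _ m1 m2; apply: ne.
by exists mu; rewrite m1 ks_id.
Qed.

(** The meet of [q] and [m]: an arbitrarily large [q] thus still names a point of a boundary path of
    degree [m]. *)
Definition dcut (m : {ffun 'I_k -> option nat}) (q : deg k) : deg k :=
  [ffun i => if m i is Some n then minn (q i) n else q i].

Lemma le_m_cut m q : le_m (dcut m q) m.
Proof. by move=> i; rewrite ffunE; case: (m i) => // n; apply: geq_minr. Qed.

Lemma le_m_trans m p q : dle p q -> le_m q m -> le_m p m.
Proof. by move=> pq qm i; have := qm i; case: (m i) => // n; apply: leq_trans. Qed.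

Lemma dle_cut m p q : dle p q -> le_m p m -> dle p (dcut m q).
Proof.
move=> pq pm i; have := pm i; rewrite ffunE; case: (m i) => // n pn.
by rewrite leq_min pn pq.
Qed.

Section Concat.
Variables (x : bpath G) (a : kP G).
Hypothesis hx : is_bpath keep x.
Hypothesis ax : ks a = bo x (dzero k).

Definition concat_deg : {ffun 'I_k -> option nat} :=
  [ffun i => omap (addn (kd a i)) (bm x i)].

Definition extend q := kcomp a (bx x (dzero k) q).

(** The initial segment of [ax] of degree [q]. As [dsub] truncates at 0, the path being cut has as
    degree the join of [q] and [kd a], so it is long enough. *)
Definition concat_pre q := kpre (extend (dsub q (kd a))) q.

Definition concat : bpath G :=
  BPath concat_deg (fun p => ks (concat_pre p)) (fun p q => ksuf (concat_pre q) p).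

Lemma le_concat_deg q : le_m q concat_deg <-> le_m (dsub q (kd a)) (bm x).
Proof.
by split=> h i; have := h i; rewrite !ffunE; case: (bm x i) => //= n;
  rewrite leq_subLR.
Qed.

Lemma bx0P q : le_m q (bm x) ->
  [/\ ks a = kr (bx x (dzero k) q), ks (bx x (dzero k) q) = bo x q
    & kd (bx x (dzero k) q) = q].
Proof.
by move=> qm; have [_ [/(_ _ _ (dle0 q) qm) [-> [-> ->]] _]] := hx; rewrite dsub0.
Qed.

Lemma kd_extend q : le_m q (bm x) -> kd (extend q) = dadd (kd a) q.
Proof. by move=> /bx0P [h1 _ h2]; rewrite kd_comp // h2. Qed.

Lemma ks_extend q : le_m q (bm x) -> ks (extend q) = bo x q.
Proof. by move=> /bx0P [h1 h2 _]; rewrite ks_comp. Qed.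

(** The initial segments of [ax] are nested: [extend t] is [extend q] followed by the segment of [x]
    from [q] to [t]. *)
Lemma kpre_extend p q t : dle q t -> le_m t (bm x) -> dle p (dadd (kd a) q) ->
  kpre (extend t) p = kpre (extend q) p.
Proof.
move=> qt tm pq; have qm := le_m_trans qt tm.
have [_ [h1 [_ [h2 _]]]] := hx.
have [q1 q2 q3] := bx0P qm; have [r1 [r2 r3]] := h1 _ _ qt tm.
have -> : extend t = kcomp (extend q) (bx x q t).
  by rewrite /extend kcompA ?q2 ?r1 // h2 //; apply: dle0.
by rewrite kpre_comp ?kd_extend // ks_extend // r1.
Qed.

Lemma concat_preE p q : le_m q (bm x) -> dle p (dadd (kd a) q) ->
  concat_pre p = kpre (extend q) p.
Proof.
move=> qm pq; rewrite /concat_pre -(@kpre_extend p _ q) //.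
  by move=> i; have := pq i; rewrite !ffunE; lia.
by move=> i; rewrite !ffunE; lia.
Qed.

Lemma dle_extend q : le_m q concat_deg -> dle q (kd (extend (dsub q (kd a)))).
Proof.
by move=> /le_concat_deg qm; rewrite kd_extend // => i; rewrite !ffunE; lia.
Qed.

Lemma kd_concat_pre q : le_m q concat_deg -> kd (concat_pre q) = q.
Proof. by move=> /dle_extend/kfactorP []. Qed.

Lemma kpre_concat_pre p q : dle p q -> le_m q concat_deg ->
  kpre (concat_pre q) p = concat_pre p.
Proof.
move=> pq qm; rewrite kpre_pre //; last exact: dle_extend.
symmetry; apply: concat_preE; first exact/le_concat_deg.
by move=> i; have := pq i; rewrite !ffunE; lia.
Qed.

Lemma concat_pre_addl q : le_m q (bm x) -> concat_pre (dadd (kd a) q) = extend q.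
Proof.
by move=> qm; rewrite /concat_pre daddnK kpre_id // kd_extend.
Qed.

Lemma keep_concat q : le_m q concat_deg -> keep (ks (concat_pre q)).
Proof.
move=> qm; have [h1 _ _] := kfactorP (dle_extend qm); rewrite h1.
apply: keep_range; rewrite ks_suf; last exact: dle_extend.
have qx : le_m (dsub q (kd a)) (bm x) by apply/le_concat_deg.
by rewrite ks_extend //; have [kx _] := hx; apply: kx.
Qed.

(* A direction [i] exhausted at [p] is exhausted at [p] joined with the degree
   of [a], where the boundary condition of [x] applies; local convexity then
   excludes an edge at [p] itself. *)
Lemma is_bpath_concat : is_bpath keep concat.
Proof.
split; first exact: keep_concat.
split=> [p q pq qm|] /=.
  have pm := le_m_trans pq qm; have pd : dle p (kd (concat_pre q)).
    by rewrite kd_concat_pre.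
  rewrite kd_suf // ks_suf // kd_concat_pre //; split=> //.
  by have [<- _ _] := kfactorP pd; rewrite kpre_concat_pre.
split=> [p pm|] /=; first by rewrite ksuf_id // kd_concat_pre.
split=> [p q t pq qt tm|p i pm] /=.
  rewrite -(kpre_concat_pre qt tm) -{2 3}(kpre_id (kd_concat_pre tm)).
  by apply: kseg_comp; rewrite ?kd_concat_pre.
rewrite ffunE; case E: (bm x i) => [n|] //= [pi].
apply/boundary_no_edge; first exact: keep_concat.
have qx : le_m (dsub p (kd a)) (bm x) by apply/le_concat_deg.
have [h1 h2 h3] := kfactorP (dle_extend pm).
move=> e; have [kx [_ [_ [_ bd]]]] := hx.
have := bd _ i qx; rewrite E !ffunE -pi addKn => /(_ erefl).
move/boundary_no_edge => /(_ (kx _ qx)); apply.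
rewrite -(ks_extend qx) -(ks_suf (dle_extend pm)).
apply: has_edge_transport => //; last by rewrite -h1.
rewrite kd_suf; last exact: dle_extend.
by rewrite kd_extend // !ffunE; lia.
Qed.

Lemma is_concat_concat : is_concat keep a x concat.
Proof.
have m0 : le_m (dzero k) (bm x) by move=> i; rewrite ffunE; case: (bm x i).
split; first exact: is_bpath_concat.
split=> //; split=> /=.
  rewrite ksuf0 -{1}[kd a]dadd0r concat_pre_addl // /extend.
  have [_ [_ [-> // _]]] := hx; by rewrite -ax kcomp_idr.
move=> q qm; rewrite concat_pre_addl //.
by have [h1 h2 h3] := bx0P qm; have [] := kfactor_comp h1 (erefl (kd a)).
Qed.

End Concat.

Lemma no_edge_cut x (M : deg k) i n : is_bpath keep x -> bm x i = Some n -> (n <= M i)%N ->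
  ~ has_edge i (bo x (dcut (bm x) M)).
Proof.
move=> hx E nM; have [kx [_ [_ [_ bd]]]] := hx.
apply/boundary_no_edge; first exact/kx/le_m_cut.
apply: bd; first exact: le_m_cut.
by rewrite !ffunE E; congr Some; lia.
Qed.

(** Where [x] has ended in direction [i] there is no [i]-edge, so [g] adds nothing in that
    direction. *)
Lemma degree_extension x a (M : deg k) i n g : is_bpath keep x -> bm x i = Some n -> (n <= M i)%N ->
  ks a = bo x (dzero k) -> kr g = bo x (dcut (bm x) M) ->
  kd (kcomp (extend x a (dcut (bm x) M)) g) i = (kd a i + n)%N.
Proof.
move=> hx E nM ha hg; have cm := @le_m_cut (bm x) M.
rewrite kd_comp ?ks_extend // kd_extend // !ffunE E.
have := no_edge_cut hx E nM; rewrite -hg; case: (posnP (kd g i)) => [->|]; last first.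
  by move=> /has_edge_of_path.
by move=> _; lia.
Qed.

(** Either [ax] and [bx] differ in degree, necessarily in a direction where [x] is finite, and no
    extension past the end changes the degree there; or they differ in some finite initial segment,
    which every extension retains. *)
Lemma separation x a b : is_bpath keep x ->
  ks a = bo x (dzero k) -> ks b = bo x (dzero k) ->
  (forall z1 z2, is_concat keep a x z1 -> is_concat keep b x z2 -> ~ beq z1 z2) ->
  exists N, forall M, dle N M -> forall g h,
    kr g = bo x (dcut (bm x) M) -> kr h = bo x (dcut (bm x) M) ->
    kcomp (extend x a (dcut (bm x) M)) g <> kcomp (extend x b (dcut (bm x) M)) h.
Proof.
move=> hx xa xb sep.
case: (pselect (concat_deg x a = concat_deg x b)) => D; last first.
  (* The finite coordinates of the degree of [x]; the infinite ones need no threshold, since both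
     concatenations are infinite there. *)
  exists [ffun i => odflt 0%N (bm x i)] => M hM g h hg hh e; apply: D.
  apply/ffunP => i; rewrite !ffunE; have := hM i; rewrite ffunE.
  case E: (bm x i) => [n|] //= nM.
  by rewrite -(degree_extension hx E nM xa hg) e (degree_extension hx E nM xb hh).
have [q [qm ne]] : exists q, le_m q (concat_deg x a) /\
    concat_pre x a q <> concat_pre x b q.
  case: (pselect (forall q, le_m q (concat_deg x a) ->
    concat_pre x a q = concat_pre x b q)) => [all|]; last first.
    by move=> /existsNP [q /not_implyP [q1 q2]]; exists q.
  (* If all initial segments agreed, the two concatenations would be equal boundary paths. *)
  exfalso; apply: (sep _ _ (is_concat_concat hx xa) (is_concat_concat hx xb)).
  by split=> // p q pq qm /=; rewrite all.
exists q => M qM g h hg hh e; apply: ne.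
have cm := @le_m_cut (bm x) M.
(* As [M] dominates [q], the cut path already contains the initial segment of [cx] of degree [q],
   whatever is appended. *)
have aux c : ks c = bo x (dzero k) -> le_m q (concat_deg x c) ->
    forall f, kr f = bo x (dcut (bm x) M) ->
    concat_pre x c q = kpre (kcomp (extend x c (dcut (bm x) M)) f) q.
  move=> cx /le_concat_deg qc f hf.
  have d : dle q (dadd (kd c) (dcut (bm x) M)).
    have h' : dle (dsub q (kd c)) (dcut (bm x) M).
      by apply: dle_cut qc => i; have := qM i; rewrite ffunE; lia.
    by move=> i; have := h' i; rewrite !ffunE; lia.
  by rewrite (concat_preE hx cx cm d) kpre_comp ?ks_extend ?kd_extend.
by rewrite (aux a xa qm g hg) e (aux b xb _ h hh) // -D.
Qed.

End BoundaryPaths.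

(** * Bilinearity in a non-unital algebra *)

Section NonUnitalAlgebra.
Variables (R : comPzRingType) (A : nualg R).
Implicit Types a b : A.

Lemma numul0l a : numul 0 a = 0.
Proof. by rewrite -(scale0r (0 : A)) numulZl !scale0r. Qed.

Lemma numul0r a : numul a 0 = 0.
Proof. by rewrite -(scale0r (0 : A)) numulZr !scale0r. Qed.

Lemma numul_suml I (r : seq I) (Q : pred I) (F : I -> A) b :
  numul (\sum_(i <- r | Q i) F i) b = \sum_(i <- r | Q i) numul (F i) b.
Proof. exact: (big_morph (fun a => numul a b) (fun x y => numulDl x y b) (numul0l b)). Qed.

Lemma numul_sumr I (r : seq I) (Q : pred I) (F : I -> A) b :
  numul b (\sum_(i <- r | Q i) F i) = \sum_(i <- r | Q i) numul b (F i).
Proof. exact: (big_morph (fun a => numul b a) (numulDr b) (numul0r b)). Qed.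

End NonUnitalAlgebra.

(** * Induction over the Kumjian-Pask algebra from its generators *)

Section Generation.
Variables (k : nat) (G : kgraph k) (R : comPzRingType).
Variables (A : nualg R) (p : kV G -> A) (s ss : kP G -> A) (P : A -> Prop).
Hypothesis KP : is_KP_algebra p s ss.
Hypotheses (P0 : P 0) (PD : forall a b, P a -> P b -> P (a + b)).
Hypothesis PZ : forall (r : R) a, P a -> P (r *: a).
Hypothesis PM : forall a b, P a -> P b -> P (numul a b).
Hypotheses (Pp : forall v, P (p v)) (Ps : forall l, P (s l)) (Pss : forall l, P (ss l)).

(** The boolean form of [P], needed to make its elements a subtype carrying a module structure. *)
Let Pb : {pred A} := fun a : A => `[< P a >].

Let Pb_closed : GRing.subsemimod_closed Pb.
Proof.
split; first split; first exact/asboolP.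
  by move=> a b /asboolP ha /asboolP hb; apply/asboolP/PD.
by move=> r a /asboolP ha; apply/asboolP/PZ.
Qed.

Let B : Type := {a : A | Pb a}.
HB.instance Definition _ := SubType.on B.
HB.instance Definition _ := Choice.on B.
HB.instance Definition _ :=
  GRing.SubChoice_isSubLmodule.Build R A Pb B Pb_closed.

Let in_B (a : A) (h : P a) : B := exist _ a (asboolT h).
Let B_P (b : B) : P (val b) := asboolW (valP b).
Let mulB (a b : B) : B := in_B (PM (B_P a) (B_P b)).

Let algB : nualg R.
Proof.
by refine (@NUAlg R B mulB _ _ _ _ _) => *; apply: val_inj;
  rewrite /= ?(numulA, numulDl, numulDr, numulZl, numulZr).
Defined.

(** The elements satisfying [P] form a subalgebra [B] containing the generators. The universal map
    to [B] followed by the inclusion fixes the generators, so by uniqueness it is the identity. *)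
Lemma KP_generated a : P a.
Proof.
have [fam univ] := KP.
pose pB v : algB := in_B (Pp v).
pose sB l : algB := in_B (Ps l).
pose ssB l : algB := in_B (Pss l).
pose iota (b : algB) : A := val (b : B).
have iotaI : injective iota by exact: val_inj.
have iota_hom : is_hom iota by [].
have iota_sum (I : Type) (r : seq I) (F : I -> algB) :
    iota (\sum_(i <- r) F i) = \sum_(i <- r) iota (F i).
  exact: (big_morph iota (fun x y => erefl) erefl).
have famB : KP_family pB sB ssB.
  have [h1 [h2 [h3 [h4 [h5 [h6 [h7 [h8 [h9 h10]]]]]]]]] := fam.
  split; first by move=> v; apply: iotaI; apply: h1.
  split; first by move=> v; apply: iotaI; apply: h2.
  split; first by move=> v; apply: iotaI; apply: h3.
  split; first by move=> v w vw; apply: iotaI; apply: h4.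
  split; first by move=> l m lm; apply: iotaI; apply: h5.
  split; first by move=> l m lm; apply: iotaI; apply: h6.
  split; first by move=> l; split; apply: iotaI; have [] := h7 l.
  split; first by move=> l; split; apply: iotaI; have [] := h8 l.
  split=> [n n0 l m hl hm|n n0 v e ue he]; apply: iotaI.
    by rewrite (fun_if iota); apply: (h9 n).
  by rewrite iota_sum; apply: (h10 n n0 v e ue he).
have [[f [f_hom [fp [fs fss]]]] _] := univ _ _ _ _ famB.
have [_ uniqA] := univ _ _ _ _ fam.
have [fD [fZ fM]] := f_hom.
have -> : a = iota (f a).
  apply: (uniqA id (iota \o f)) => //=.
  - by split=> [x y|]; rewrite /= ?fD //; split=> [r x|x y] /=; rewrite ?fZ ?fM.
  - by move=> v; rewrite fp.
  - by move=> l; rewrite fs.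
  - by move=> l; rewrite fss.
exact: B_P.
Qed.

End Generation.

(** * Calculus of the monomials s_a s_b^* *)

Section KPCalculus.
Variables (k : nat) (G : kgraph k) (R : comPzRingType).
Variables (A : nualg R) (p : kV G -> A) (s ss : kP G -> A).
Hypothesis rf : row_finite G.
Hypothesis fam : KP_family p s ss.
Implicit Types (v : kV G) (a b l g h : kP G) (n N : deg k).
Implicit Types (t u : R * kP G * kP G) (e : seq (R * kP G * kP G)).

Local Notation in_leT := (in_le (@allV k G)).

Lemma s_kid v : s (kid v) = p v. Proof. by have [? _] := fam. Qed.
Lemma ss_kid v : ss (kid v) = p v. Proof. by have [_ [? _]] := fam. Qed.
Lemma p_idem v : numul (p v) (p v) = p v. Proof. by have [_ [_ [? _]]] := fam. Qed.

Lemma p_orth v w : v <> w -> numul (p v) (p w) = 0.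
Proof. by have [_ [_ [_ [h _]]]] := fam; apply: h. Qed.

Lemma s_comp a b : ks a = kr b -> numul (s a) (s b) = s (kcomp a b).
Proof. by have [_ [_ [_ [_ [h _]]]]] := fam; apply: h. Qed.

Lemma ss_comp a b : ks a = kr b -> numul (ss b) (ss a) = ss (kcomp a b).
Proof. by have [_ [_ [_ [_ [_ [h _]]]]]] := fam; apply: h. Qed.

Lemma p_s l : numul (p (kr l)) (s l) = s l.
Proof. by have [_ [_ [_ [_ [_ [_ [h _]]]]]]] := fam; have [] := h l. Qed.

Lemma s_p l : numul (s l) (p (ks l)) = s l.
Proof. by have [_ [_ [_ [_ [_ [_ [h _]]]]]]] := fam; have [] := h l. Qed.

Lemma p_ss l : numul (p (ks l)) (ss l) = ss l.
Proof. by have [_ [_ [_ [_ [_ [_ [_ [h _]]]]]]]] := fam; have [] := h l. Qed.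

Lemma ss_p l : numul (ss l) (p (kr l)) = ss l.
Proof. by have [_ [_ [_ [_ [_ [_ [_ [h _]]]]]]]] := fam; have [] := h l. Qed.

Lemma in_le0 l : in_leT (dzero k) l -> l = kid (kr l).
Proof.
move=> [_ [l0 _]]; apply: kd0_id; apply/ffunP => i; apply/eqP.
by have := l0 i; rewrite !ffunE leqn0.
Qed.

(** For [n = 0] both paths are vertices, and (KP3) becomes idempotence and orthogonality. *)
Lemma ss_s n a b : in_leT n a -> in_leT n b ->
  numul (ss a) (s b) = if a == b then p (ks a) else 0.
Proof.
case: (eqVneq n (dzero k)) => [-> /in_le0 -> /in_le0 ->|/eqP n0 ha hb].
  rewrite ss_kid s_kid ks_id; case: eqP => [/(congr1 (@kr _ _))|ab].
    by rewrite !kr_id => ->; apply: p_idem.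
  by apply: p_orth => ab'; apply: ab; rewrite ab'.
have [_ [_ [_ [_ [_ [_ [_ [_ [h _]]]]]]]]] := fam; exact: (h n n0 a b ha hb).
Qed.

Lemma ss_s_same l : numul (ss l) (s l) = p (ks l).
Proof. by rewrite (@ss_s (kd l)) ?eqxx //; apply: in_le_kd. Qed.

Lemma p_expand n v : exists e : seq (kP G),
  (forall l, l \in e -> in_leT n l /\ kr l = v) /\
  p v = \sum_(l <- e) numul (s l) (ss l).
Proof.
case: (eqVneq n (dzero k)) => [->|/eqP n0].
  exists [:: kid v]; split=> [l|].
    rewrite inE => /eqP ->; rewrite kr_id; split=> //.
    by apply: in_le_kd; rewrite kd_id.
  by rewrite big_seq1 s_kid ss_kid p_idem.
have [e [ue he]] := finite_in_le rf n v; exists e; split=> [l /he//|].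
have [_ [_ [_ [_ [_ [_ [_ [_ [_ h]]]]]]]]] := fam; exact: (h n n0 v e ue he).
Qed.

Definition term t : A := t.1.1 *: numul (s t.1.2) (ss t.2).

(** Insert p_{s(b)} between the two factors and expand it by (KP4). *)
Lemma mono_expand n a b : ks a = ks b -> exists e : seq (kP G),
  (forall l, l \in e -> in_leT n l /\ kr l = ks b) /\
  numul (s a) (ss b) = \sum_(l <- e) numul (s (kcomp a l)) (ss (kcomp b l)).
Proof.
move=> ab; have [e [he pe]] := p_expand n (ks b); exists e; split=> //.
rewrite -(p_ss b) pe numul_suml numul_sumr big_seq [RHS]big_seq.
apply: eq_bigr => l /he [_ hl].
by rewrite numulA ss_comp // -numulA s_comp // ab.
Qed.

(** Expand p_{s(a)} over paths [g] bounded by d(b), and p_{s(b)} over paths [h] bounded by d(a). All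
    [ag] and [bh] then lie in one set of paths bounded by d(a) + d(b), where (KP3) leaves only the
    pairs with [ag = bh]. *)
Lemma ss_s_expand a b : exists e : seq (kP G * kP G),
  (forall gh, gh \in e ->
     [/\ ks a = kr gh.1, ks b = kr gh.2 & kcomp a gh.1 = kcomp b gh.2]) /\
  numul (ss a) (s b) = \sum_(gh <- e) numul (s gh.1) (ss gh.2).
Proof.
have [ea [ha pa]] := p_expand (kd b) (ks a).
have [eb [hb pb]] := p_expand (kd a) (ks b).
pose n := dadd (kd a) (kd b).
have na : dsub n (kd a) = kd b by rewrite daddnK.
have nb : dsub n (kd b) = kd a.
  by apply/ffunP => i; rewrite !ffunE addnK.
have le_na : dle (kd a) n by apply: dle_addr.
have le_nb : dle (kd b) n by move=> i; rewrite ffunE leq_addl.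
exists [seq gh <- allpairs pair ea eb | kcomp a gh.1 == kcomp b gh.2]; split.
  move=> gh; rewrite mem_filter => /andP [/eqP e].
  by case/allpairsP => -[g h] /= [/ha [_ g2] /hb [_ h2] E]; rewrite E in e *.
rewrite big_filter big_mkcond big_allpairs_dep /=.
rewrite -(p_ss a) -(s_p b) pa pb numul_suml numul_suml [LHS]big_seq [RHS]big_seq.
apply: eq_bigr => g /ha [g1 g2].
rewrite numul_sumr numul_sumr [LHS]big_seq [RHS]big_seq; apply: eq_bigr => h /hb [h1 h2].
rewrite [numul (numul (s g) (ss g)) (ss a)]numulA ss_comp //.
rewrite -[numul (s b) _]numulA s_comp // numulA -[numul (ss _) (numul _ _)]numulA.
rewrite (@ss_s n); last 2 first.
- by apply: in_le_comp; rewrite ?na.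
- by apply: in_le_comp; rewrite ?nb.
case: eqP => [e|_]; last by rewrite numul0l numul0r.
by rewrite ks_comp // -numulA s_p.
Qed.

Lemma ss_s_disjoint a b :
  (forall g h, ks a = kr g -> ks b = kr h -> kcomp a g <> kcomp b h) ->
  numul (ss a) (s b) = 0.
Proof.
move=> H; have [[|gh e] [he ->]] := ss_s_expand a b; first by rewrite big_nil.
by exfalso; have [] := he gh (mem_head _ _); apply: H.
Qed.

Definition spanned (x : A) := exists e, x = \sum_(t <- e) term t.

Lemma spanned_sum (I : eqType) (r : seq I) (F : I -> A) :
  (forall i, i \in r -> spanned (F i)) -> spanned (\sum_(i <- r) F i).
Proof.
elim: r => [|i r IH] h; first by exists [::]; rewrite !big_nil.
have [e1 h1] := h i (mem_head _ _).
have [|e2 h2] := IH; first by move=> j jr; apply: h; rewrite in_cons jr orbT.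
by exists (e1 ++ e2); rewrite big_cons big_cat h1 h2.
Qed.

Lemma spanned_scale (r : R) x : spanned x -> spanned (r *: x).
Proof.
move=> [e ->]; exists [seq (r * t.1.1, t.1.2, t.2) | t <- e].
by rewrite big_map scaler_sumr; apply: eq_bigr => t _; rewrite scalerA.
Qed.

Lemma spanned_mono a b : spanned (numul (s a) (ss b)).
Proof. by exists [:: (1, a, b)]; rewrite big_seq1 /term scale1r. Qed.

Lemma s_orth a b : ks a <> kr b -> numul (s a) (s b) = 0.
Proof.
by move=> h; rewrite -(s_p a) numulA -(p_s b) -(numulA (p _)) p_orth // numul0l numul0r.
Qed.

Lemma ss_orth a b : ks a <> kr b -> numul (ss b) (ss a) = 0.
Proof.
move=> h; rewrite -(ss_p b) numulA -(p_ss a) -(numulA (p _)) p_orth ?numul0l ?numul0r //.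
exact: nesym.
Qed.

Lemma s_ss_orth a b : ks a <> ks b -> numul (s a) (ss b) = 0.
Proof.
by move=> h; rewrite -(s_p a) numulA -(p_ss b) -(numulA (p _)) p_orth // numul0l numul0r.
Qed.

(** Once the inner product s_b^* s_c is expanded, the outer factors compose to a monomial, or vanish
    when the endpoints do not match. *)
Lemma spanned_mul x y : spanned x -> spanned y -> spanned (numul x y).
Proof.
move=> [e1 ->] [e2 ->]; rewrite numul_suml; apply: spanned_sum => t _.
rewrite numul_sumr; apply: spanned_sum => u _.
rewrite /term numulZl numulZr; do 2 apply: spanned_scale.
rewrite numulA -(numulA (ss _)); have [e [_ ->]] := ss_s_expand t.2 u.1.2.
rewrite numul_suml numul_sumr; apply: spanned_sum => gh _.
rewrite numulA -numulA.
case: (eqVneq (ks t.1.2) (kr gh.1)) => [h1|/eqP/s_orth ->]; last first.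
  by rewrite numul0l; exists [::]; rewrite big_nil.
case: (eqVneq (ks u.2) (kr gh.2)) => [h2|/eqP/ss_orth ->]; last first.
  by rewrite numul0r; exists [::]; rewrite big_nil.
by rewrite s_comp // ss_comp //; apply: spanned_mono.
Qed.

Definition degree a b : {ffun 'I_k -> int} := [ffun i => (kd a i)%:Z - (kd b i)%:Z].

(** One bound [N] for all second paths makes (KP3) applicable to any two of them. *)
Definition normal_form N e :=
  forall t, t \in e -> ks t.1.2 = ks t.2 /\ in_leT N t.2.

(** Each monomial is lengthened by paths [l] until its second path is maximal below [N]. Both of its
    paths grow by the same [l], so degrees persist and the equality survives every selection [Q] of
    degrees. Terms with distinct sources are zero. *)
Lemma normalize N e : (forall t, t \in e -> dle (kd t.2) N) ->
  exists e', normal_form N e' /\ forall Q : pred {ffun 'I_k -> int},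
    \sum_(t <- e | Q (degree t.1.2 t.2)) term t =
    \sum_(t <- e' | Q (degree t.1.2 t.2)) term t.
Proof.
elim: e => [|[[r a] b] e IH] hN; first by exists [::]; split=> // Q; rewrite !big_nil.
have [|e' [nf he']] := IH; first by move=> t te; apply: hN; rewrite in_cons te orbT.
have bN : dle (kd b) N by exact: (hN _ (mem_head _ _)).
case: (eqVneq (ks a) (ks b)) => [ab|/eqP/s_ss_orth ab]; last first.
  exists e'; split=> // Q; rewrite big_cons /= he' /term /= ab scaler0 add0r.
  by case: ifP.
have [el [hel E]] := mono_expand (dsub N (kd b)) ab.
exists ([seq (r, kcomp a l, kcomp b l) | l <- el] ++ e'); split=> [t|Q].
  rewrite mem_cat => /orP [/mapP [l /hel [h1 h2] ->] /=|/nf//].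
  by rewrite !ks_comp // ?ab //; split=> //; apply: in_le_comp.
rewrite big_cons big_cat big_map /= he' /term /= E.
have D l : l \in el -> degree (kcomp a l) (kcomp b l) = degree a b.
  move=> /hel [_ hl]; apply/ffunP => i; rewrite !ffunE !kd_comp ?ab // !ffunE.
  by lia.
have -> : \sum_(l <- el | Q (degree (kcomp a l) (kcomp b l)))
      r *: numul (s (kcomp a l)) (ss (kcomp b l)) =
    if Q (degree a b) then
      r *: \sum_(l <- el) numul (s (kcomp a l)) (ss (kcomp b l)) else 0.
  rewrite big_seq_cond scaler_sumr; case: ifP => q.
    by rewrite [RHS]big_seq; apply: eq_bigl => l; apply: andb_idr => /D ->.
  by apply: big1 => l /andP [/D ->]; rewrite q.
by case: ifP; rewrite ?add0r.
Qed.

Definition coef e a b : R := \sum_(t <- e | (t.1.2 == a) && (t.2 == b)) t.1.1.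

Lemma sum_by_coef (Q : rel (kP G)) e :
  \sum_(t <- e | Q t.1.2 t.2) term t =
  \sum_(ab <- undup [seq (t.1.2, t.2) | t <- e] | Q ab.1 ab.2)
    coef e ab.1 ab.2 *: numul (s ab.1) (ss ab.2).
Proof.
set r := undup _.
under [RHS]eq_bigr do rewrite /coef scaler_suml big_mkcond.
rewrite exchange_big big_mkcond big_seq [RHS]big_seq /=; apply: eq_bigr => t te.
have tr : (t.1.2, t.2) \in r by rewrite mem_undup; apply: map_f.
(* After the exchange, [t] contributes only at its own pair, which occurs exactly once in [r]. *)
rewrite big_mkcond (bigD1_seq _ tr) ?undup_uniq //= !eqxx /= [X in _ + X]big1 ?addr0 //.
move=> [a b] /= ne; have -> : (t.1.2 == a) && (t.2 == b) = false.
  by apply: contraNF ne => /andP [/eqP -> /eqP ->].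
by case: ifP.
Qed.

End KPCalculus.

(** * The set H(J) and the coefficients of elements of J *)

Section Ideals.
Variables (k : nat) (G : kgraph k) (R : comPzRingType).
Variables (A : nualg R) (p : kV G -> A) (s ss : kP G -> A) (J : A -> Prop).
Hypothesis rf : row_finite G.
Hypothesis lc : locally_convex G.
Hypothesis fam : KP_family p s ss.
Hypothesis J_ideal : is_ideal J.
Hypothesis J_basic : basic p J.
Hypothesis cB : condB (fun v : kV G => ~ HI p J v).
Implicit Types (e : seq (R * kP G * kP G)).

Local Notation keep := (fun v : kV G => ~ HI p J v).
Local Notation term := (term s ss).

Lemma ideal_sum (I : A -> Prop) (T : eqType) (r : seq T) (Q : pred T) (F : T -> A) :
  is_ideal I -> (forall t, t \in r -> I (F t)) -> I (\sum_(t <- r | Q t) F t).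
Proof.
move=> [I0 [ID _]] h; rewrite big_seq_cond; apply: (big_ind I) => //.
by move=> t /andP [/h].
Qed.

(** Heredity of H(J), from p_{s(l)} = s_l^* p_{r(l)} s_l. *)
Lemma HI_source l : J (p (kr l)) -> J (p (ks l)).
Proof.
have [_ [_ [_ [Jl Jr]]]] := J_ideal => h.
by rewrite -(ss_s_same fam) -(p_s fam l); apply/Jl/Jr.
Qed.

Lemma ideal_term (I : A -> Prop) (r : R) a b :
  is_ideal I -> I (p (ks b)) -> I (r *: numul (s a) (ss b)).
Proof.
move=> [_ [_ [_ [Il Ir]]]] h.
by rewrite -numulZl -(p_ss fam b); apply/Il/Ir.
Qed.

(** If every [i]-edge at [v] had its source in H(J), then (KP4) for the degree e_i would put p_v in
    [J]. *)
Lemma HI_saturated (v : kV G) i : keep v -> has_edge i v ->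
  exists l : kP G, [/\ kr l = v, kd l = dunit i & keep (ks l)].
Proof.
move=> kv [m [mv mi]]; apply: contrapT => none; apply: kv.
have [e [he ev]] := p_expand rf fam (dunit i) v.
rewrite /HI ev; apply: ideal_sum => // l /he [[_ [ld lmax]] lv].
rewrite -[numul _ _]scale1r; apply: ideal_term => //.
apply: contrapT => kl; apply: none; exists l; split=> //.
(* A summand of degree 0 would be [v] itself, which the [i]-edge [m] at [v] rules out. *)
case: (posnP (kd l i)) => [l0|li].
  have eq0 : kd l = dzero k.
    apply/ffunP => j; rewrite ffunE; apply/eqP; rewrite -leqn0.
    by have := ld j; rewrite ffunE; case: eqP => // ->; rewrite l0.
  exfalso; apply: (lmax i _ m _ _ mi) => //; first by rewrite l0 ffunE eqxx.
  by rewrite (kd0_id eq0) ks_id lv.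
apply/ffunP => j; apply/eqP; rewrite eqn_leq ld /= ffunE.
by case: eqP => // ->.
Qed.

Lemma coef_eq0 N e t0 : normal_form N e -> J (\sum_(t <- e) term t) ->
  t0 \in e -> keep (ks t0.2) -> coef e t0.1.2 t0.2 = 0.
Proof.
move=> nf Je t0e kb; set a := t0.1.2; set b := t0.2.
have [ab bN] : ks a = ks b /\ in_le (@allV k G) N b by apply: nf.
have kr_keep (l : kP G) : keep (ks l) -> keep (kr l).
  by move=> h1 h2; apply/h1/HI_source.
have [x [hx [xv sep]]] := cB kb.
(* One cut-off [M] for all terms of the list. Only first paths with source s(b) matter, those being
   the ones that can precede [x]. *)
have [|M hM] := @dle_eventually_all k _ (fun t M => ks t.1.2 = ks b -> t.1.2 <> a ->
    forall g h, kr g = bo x (dcut (bm x) M) -> kr h = bo x (dcut (bm x) M) ->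
    kcomp (extend x a (dcut (bm x) M)) g <> kcomp (extend x t.1.2 (dcut (bm x) M)) h) e.
  move=> t te.
  case: (pselect (ks t.1.2 = ks b /\ t.1.2 <> a)) => [[tb ta]|n]; last first.
    by exists (dzero k) => M _ h1 h2; case: n.
  have in_subE (c : kP G) : ks c = ks b -> in_sub keep c.
    by move=> cb; split; [apply: kr_keep|]; rewrite cb.
  have xa : ks a = bo x (dzero k) by rewrite xv.
  have xt : ks t.1.2 = bo x (dzero k) by rewrite xv.
  have [|N' hN'] := separation lc kr_keep HI_saturated hx xa xt; last first.
    by exists N' => M /hN' h _ _.
  by move=> z1 z2; apply: sep; rewrite ?xv; [exact: in_subE..| | |exact: nesym].
have {hM} := hM _ (dle_refl M).
set q := dcut (bm x) M => hM.
have qx : le_m q (bm x) by apply: le_m_cut.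
have ax : ks a = bo x (dzero k) by rewrite xv.
have [h1 h2 _] := bx0P hx ax qx.
have kq : keep (bo x q) by have [kx _] := hx; apply: kx.
have Jc : J (coef e a b *: p (bo x q)).
  have [_ [_ [_ [Jl Jr]]]] := J_ideal.
  (* The compression, with xi the segment of [x] from 0 to [q]: [extend x a q] is a xi and
     [extend x b q] is b xi. *)
  suff -> : coef e a b *: p (bo x q) =
      numul (ss (extend x a q)) (numul (\sum_(t <- e) term t) (s (extend x b q))).
    exact/Jl/Jr.
  rewrite numul_suml numul_sumr /coef scaler_suml big_mkcond.
  rewrite big_seq [RHS]big_seq; apply: eq_bigr => t te.
  have [tt tN] := nf t te.
  rewrite numulZl numulZr numulA -(s_comp fam) -?ab // -(numulA (ss t.2)).
  (* Both second paths are maximal below [N], so (KP3) kills every term whose second path is not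
     [b]. *)
  rewrite (ss_s fam tN bN) andbC; case: eqP => [tb|_]; last first.
    by rewrite numul0l !numul0r scaler0.
  rewrite -/b tb -ab h1 (p_s fam) (s_comp fam) ?tt ?tb -?ab //.
  case: eqP => [->|ta].
    by rewrite (ss_s_same fam) ks_comp // h2.
  (* What is left has a first path other than [a]; by the choice of [M] it admits no common
     extension with a xi. *)
  rewrite (ss_s_disjoint rf fam) ?scaler0 // => g h hg hh.
  apply: hM => //; first by rewrite tt tb.
    by rewrite -hg (ks_extend hx ax qx).
  by rewrite -hh (ks_extend hx _ qx) // tt tb -ab.
by apply: contrapT => /eqP c0; apply: kq; apply: J_basic Jc.
Qed.

(** Each coefficient vanishes unless the source is in H(J). The generality in [I] and [Q] serves two
    ends: [J] inside I(H(J)) with all terms selected, and gradedness with [I] equal to [J] and one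
    degree selected. *)
Lemma ideal_part (I : A -> Prop) (Q : rel (kP G)) N e :
  is_ideal I -> (forall v, HI p J v -> I (p v)) ->
  normal_form N e -> J (\sum_(t <- e) term t) ->
  I (\sum_(t <- e | Q t.1.2 t.2) term t).
Proof.
move=> II HJ nf Je; rewrite sum_by_coef; apply: ideal_sum => // ab.
rewrite mem_undup => /mapP [t te ->] /=.
case: (pselect (HI p J (ks t.2))) => [/HJ h|kt]; first exact: ideal_term.
by rewrite (coef_eq0 nf Je te kt) scale0r; have [] := II.
Qed.

(** As the listed degrees are distinct, the degree of a monomial tells which component it came from,
    so filtering by degree recovers that component. *)
Lemma homog_collect (E : seq ({ffun 'I_k -> int} * A)) :
  uniq (map fst E) -> (forall t, t \in E -> homog s ss t.1 t.2) ->
  exists e, [/\ forall u, u \in e -> degree u.1.2 u.2 \in map fst E,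
    \sum_(t <- E) t.2 = \sum_(u <- e) term u
    & forall t, t \in E -> t.2 = \sum_(u <- e | degree u.1.2 u.2 == t.1) term u].
Proof.
elim: E => [|[n a] E IH] /=; first by exists [::]; split; rewrite ?big_nil.
move=> /andP [nE uE] hE.
have [|e2 [d2 s2 c2]] := IH uE; first by move=> t tE; apply: hE; rewrite in_cons tE orbT.
have [e1 [d1 /= s1]] := hE _ (mem_head _ _).
have {}d1 u : u \in e1 -> degree u.1.2 u.2 = n.
  by move=> ue; apply/ffunP => i; rewrite ffunE (d1 _ ue).
exists (e1 ++ e2); split.
- move=> u; rewrite mem_cat in_cons => /orP [/d1 ->|/d2 ->]; by rewrite ?eqxx ?orbT.
- by rewrite big_cons big_cat s2 s1.
move=> t; rewrite in_cons => /orP [/eqP ->|tE] /=; rewrite big_cat /=.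
  rewrite s1 [X in _ + X]big_seq_cond [X in _ + X]big1 => [|u /andP [/d2 h /eqP hn]]; last first.
    by rewrite -hn h in nE.
  rewrite addr0 big_seq [RHS]big_seq_cond; apply: eq_bigl => u.
  by symmetry; apply: andb_idr => /d1 ->.
rewrite [X in X + _]big_seq_cond [X in X + _]big1 ?add0r; first exact: c2.
move=> u /andP [/d1 -> /eqP nt]; case/negP: nE.
by rewrite nt; apply: map_f.
Qed.

End Ideals.

(** * Equality with I(H(J)) and gradedness *)

Theorem mainTheorem3 (k : nat) (G : kgraph k) (R : comPzRingType)
  (A : nualg R) (p : kV G -> A) (s ss : kP G -> A) (J : A -> Prop) :
  row_finite G -> locally_convex G ->
  is_KP_algebra p s ss -> is_ideal J -> basic p J ->
  condB (fun v : kV G => ~ HI p J v) ->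
  (forall a, J a <-> IH p (HI p J) a) /\ basic p J /\ graded s ss J.
Proof.
move=> rf lc KP JI Jb cB; have [fam _] := KP.
have normal e : exists N e', normal_form N e' /\
    forall Q : pred {ffun 'I_k -> int},
    \sum_(t <- e | Q (degree t.1.2 t.2)) term s ss t =
    \sum_(t <- e' | Q (degree t.1.2 t.2)) term s ss t.
  have [|N hN] := @dle_eventually_all k _ (fun t M => dle (kd t.2) M) e.
    by move=> t _; exists (kd t.2).
  by exists N; apply: (normalize rf fam) => t; apply: hN (dle_refl _) t.
split=> [a|]; last split=> //.
  (* I(H(J)) lies in [J] because [J] is itself an ideal containing the generating vertices. *)
  split=> [Ja I II HJ|]; last by apply.
  have [e E] : spanned s ss a.
    apply: (KP_generated KP); first by exists [::]; rewrite big_nil.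
    - move=> x y [e1 ->] [e2 ->]; exists (e1 ++ e2); by rewrite big_cat.
    - exact: spanned_scale.
    - exact: (spanned_mul rf fam).
    - by move=> v; rewrite -(p_idem fam) -{1}(s_kid fam) -(ss_kid fam); apply: spanned_mono.
    - by move=> l; rewrite -(s_p fam) -(ss_kid fam); apply: spanned_mono.
    - by move=> l; rewrite -(p_ss fam) -(s_kid fam); apply: spanned_mono.
  have [N [e' [nf he']]] := normal e; rewrite E (he' xpredT) in Ja *.
  exact: (ideal_part rf lc fam JI Jb cB (fun _ _ => true) II HJ nf Ja).
(* Normalisation respects degrees, so the component is the part of a normal form selected by degree
   [t.1], and this part stays in [J]. *)
move=> E uE hE JE t tE; have [e [_ sE cE]] := homog_collect uE hE.
have [N [e' [nf he']]] := normal e.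
rewrite sE (he' xpredT) in JE; rewrite cE // (he' (pred1 t.1)).
exact: (ideal_part rf lc fam JI Jb cB (fun a b => degree a b == t.1) JI _ nf JE).
Qed.
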